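(* Let $N\ge 1$ and let $\mu_1,\dots,\mu_N$ be nonzero real numbers. If $(\bar r,\bar\theta)=(1,\dots,1,\bar\theta_1,\dots,\bar\theta_N)$ is a relative equilibrium (in polar coordinates) of the $(1+N)$-vortex problem with circulation weights $\mu_1,\dots,\mu_N$, then $\bar\theta=(\bar\theta_1,\dots,\bar\theta_N)$ is a critical point of the function $$V(\theta)=-\sum_{1\le i<j\le N}\mu_i\mu_j\Big[\cos(\theta_i-\theta_j)+\tfrac12\log\big(2-2\cos(\theta_i-\theta_j)\big)\Big].$$
   Context: Write $(x,y)^\perp=(-y,x)$. A relative equilibrium configuration of the $(N+1)$-vortex problem with nonzero circulations $\Gamma_0,\dots,\Gamma_N$ and rotation rate $\omega$ is a tuple of distinct points $q_0,\dots,q_N\in\mathbb{R}^2$, with center of vorticity at the origin ($\sum_{i=0}^N\Gamma_i q_i=0$), such that $$\omega\,\Gamma_i q_i^\perp+\sum_{j\ne i}\frac{\Gamma_i\Gamma_j (q_j-q_i)^\perp}{|q_i-q_j|^2}=0,\qquad i=0,\dots,N.$$ Equivalently, $q_i(t)=R(t)^{-1}q_i$, where $R(t)^{-1}$ is the rotation by angle $\omega t$, solves the point vortex equations $\dot q_i=\sum_{j\neq i}\Gamma_j (q_i-q_j)^\perp/|q_i-q_j|^2$. Throughout, the rotation rate is fixed to be $\omega=1$. A relative equilibrium of the $(1+N)$-vortex problem with weights $\mu_1,\dots,\mu_N$ is a configuration $\bar q_0,\dots,\bar q_N$ for which there exist a sequence of nonzero reals $\varepsilon_k\to0$ and relative equilibrium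 configurations $q_0^k,\dots,q_N^k$ of the $(N+1)$-vortex problem with circulations $\Gamma_0^k=1$, $\Gamma_i^k=\varepsilon_k\mu_i$ ($i=1,\dots,N$), such that $q_j^k\to\bar q_j$ as $k\to\infty$ for every $j=0,\dots,N$. It is assumed throughout that the vortices do not collide in the limit: there is $m>0$, independent of $k$, with $|q_i^k-q_j^k|>m$ for all $i\ne j$ and all $k$. Heliocentric coordinates are $Z_0=q_0$, $Z_i=q_i-q_0$ for $i=1,\dots,N$. The polar coordinates $(r,\theta)=(r_1,\dots,r_N,\theta_1,\dots,\theta_N)$ of a configuration are given by $Z_i=(r_i\cos\theta_i,r_i\sin\theta_i)$, $i=1,\dots,N$; the limit configuration satisfies $\bar q_0=0$. *)

(* Defs.v *)
From HB Require Import structures.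
From mathcomp Require Import all_boot all_order all_algebra.
From mathcomp Require Import all_classical all_reals all_analysis.

Set Implicit Arguments.
Unset Strict Implicit.
Unset Printing Implicit Defensive.

Import Order.TTheory GRing.Theory Num.Theory.
Import numFieldNormedType.Exports.
Local Open Scope classical_set_scope.
Local Open Scope ring_scope.

Section Vortices.
Context {R : realType}.

Definition perp (p : R * R) : R * R := (- p.2, p.1).

(* The library norm on [R * R] is the sup norm, hence this definition. *)
Definition enorm (p : R * R) : R := Num.sqrt (p.1 ^+ 2 + p.2 ^+ 2).

Definition relative_equilibrium (N : nat) (omega : R) (Gamma : 'I_N.+1 -> R)
    (q : 'I_N.+1 -> R * R) : Prop :=
  [/\ forall i, Gamma i != 0,
      injective q,
      \sum_i Gamma i *: q i = 0 &
      forall i, (omega * Gamma i) *: perp (q i)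
        + \sum_(j | j != i)
            (Gamma i * Gamma j / enorm (q i - q j) ^+ 2) *: perp (q j - q i)
        = 0].

(* The vortex of index [i : 'I_N] (i.e. the (i+1)-st small one) sits at position
   [lift ord0 i : 'I_N.+1]; position [ord0] is the strong vortex. *)
Definition circulations (N : nat) (mu : 'I_N -> R) (eps : R) (i : 'I_N.+1) : R :=
  if unlift ord0 i is Some j then eps * mu j else 1.

(* The rotation rate is normalised to 1, and the absence of collisions in the
   limit is part of the definition. *)
Definition limit_relative_equilibrium (N : nat) (mu : 'I_N -> R)
    (qbar : 'I_N.+1 -> R * R) : Prop :=
  exists (eps : nat -> R) (q : nat -> 'I_N.+1 -> R * R),
    [/\ forall k, eps k != 0,
        eps k @[k --> \oo] --> (0 : R),
        forall k, relative_equilibrium 1 (circulations mu (eps k)) (q k),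
        forall j, q k j @[k --> \oo] --> qbar j &
        exists2 m : R, 0 < m &
          forall k i j, i != j -> m < enorm (q k i - q k j)].

Definition heliocentric (N : nat) (q : 'I_N.+1 -> R * R) (i : 'I_N) : R * R :=
  q (lift ord0 i) - q ord0.

Definition polar_coordinates (N : nat) (q : 'I_N.+1 -> R * R)
    (r theta : 'rV[R]_N) : Prop :=
  forall i : 'I_N, heliocentric q i =
    (r ord0 i * cos (theta ord0 i), r ord0 i * sin (theta ord0 i)).

(* [qbar ord0 = 0] is not required: it follows from the center of vorticity of
   the approximating configurations being at the origin. *)
Definition polar_limit_relative_equilibrium (N : nat) (mu : 'I_N -> R)
    (r theta : 'rV[R]_N) : Prop :=
  exists2 qbar : 'I_N.+1 -> R * R,
    limit_relative_equilibrium mu qbar & polar_coordinates qbar r theta.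

Definition V (N : nat) (mu : 'I_N -> R) (theta : 'rV[R]_N) : R :=
  - \sum_(i < N) \sum_(j < N | (i < j)%N)
      mu i * mu j *
        (cos (theta ord0 i - theta ord0 j)
         + 2^-1 * ln (2 - 2 * cos (theta ord0 i - theta ord0 j))).

(* Since [ln] is total (with junk value 0 outside the positive reals), the
   natural domain of [V] is recorded separately. *)
Definition V_domain (N : nat) : set 'rV[R]_N :=
  [set theta | forall i j : 'I_N, (i < j)%N ->
     0 < 2 - 2 * cos (theta ord0 i - theta ord0 j)].

Definition critical_point (N : nat) (D : set 'rV[R]_N) (f : 'rV[R]_N -> R)
    (x : 'rV[R]_N) : Prop :=
  [/\ D x, differentiable f x & forall v, 'd f x v = 0].

End Vortices.
Arguments V_domain : clear implicits.

(* Main.v *)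
Require Import Defs.
From HB Require Import structures.
From mathcomp Require Import all_boot all_order all_algebra.
From mathcomp Require Import all_classical all_reals all_analysis.
From mathcomp Require Import ring lra.
Import Order.TTheory GRing.Theory Num.Theory.
Import numFieldNormedType.Exports.
Local Open Scope classical_set_scope.
Local Open Scope ring_scope.

(** Write Z_a for the position of the small vortex a relative to the strong
    one. To leading order the equation of motion of the vortex a only involves
    the strong vortex and says |Z_a| = 1; it carries no information on the
    angles. That information sits at the next order in epsilon and is isolated
    by taking the wedge product with Z_a, that is, by looking at the torque
    about the strong vortex: the dominant attraction is along Z_a and drops
    out. The rotation term is eliminated with the equation of the strong
    vortex. What remains is exact for every epsilon and, apart from a common
    factor epsilon, consists of terms that converge ([torque_balance]):
      sum over b <> a of mu_b (Z_a ^ Z_b) (1/|Z_a - Z_b|^2 - 1/|Z_b|^2) = 0.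
    Dividing by epsilon and passing to the limit, which the absence of
    collisions permits, gives the same identity for the limit configuration
    ([limit_torque_balance]).

    On the unit circle Z_a ^ Z_b = - sin (theta_a - theta_b) and
    |Z_a - Z_b|^2 = 2 - 2 cos (theta_a - theta_b), so the left-hand side is,
    up to a nonzero factor, the partial derivative of V with respect to
    theta_a ([is_diff_V]). *)

(** * Plane vectors *)

Section Plane.
Context {R : realType}.
Implicit Types p q w z : R * R.

Definition wedge p q : R := p.1 * q.2 - p.2 * q.1.

Definition dot p q : R := p.1 * q.1 + p.2 * q.2.

Lemma dotDr z p q : dot z (p + q) = dot z p + dot z q.
Proof. by rewrite /dot /=; ring. Qed.

Lemma dot0r z : dot z 0 = 0.
Proof. by rewrite /dot /= !mulr0 addr0. Qed.

Lemma dot_sumr (I : Type) (r : seq I) (P : pred I) (F : I -> R * R) z :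
  dot z (\sum_(i <- r | P i) F i) = \sum_(i <- r | P i) dot z (F i).
Proof. exact: (big_morph (dot z) (dotDr z) (dot0r z)). Qed.

Lemma dotZ_perp a z p : dot z (a *: perp p) = - (a * wedge z p).
Proof. by rewrite /dot /wedge /= /GRing.scale /=; ring. Qed.

Lemma enorm_sqr p : enorm p ^+ 2 = p.1 ^+ 2 + p.2 ^+ 2.
Proof. by rewrite /enorm sqr_sqrtr// addr_ge0// sqr_ge0. Qed.

Lemma enorm_sqr_eq0 p : (enorm p ^+ 2 == 0) = (p == 0).
Proof. by rewrite enorm_sqr paddr_eq0 ?sqr_ge0// !sqrf_eq0; case: p. Qed.

Lemma enorm_ge0 p : 0 <= enorm p.
Proof. exact: sqrtr_ge0. Qed.

Lemma enorm_sqrB p q : enorm (p - q) ^+ 2 = enorm (q - p) ^+ 2.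
Proof. by rewrite !enorm_sqr /=; ring. Qed.

Lemma enorm_polar (t : R) : enorm (cos t, sin t) ^+ 2 = 1.
Proof. by rewrite enorm_sqr /= cos2Dsin2. Qed.

Lemma chord_polar (s t : R) :
  enorm ((cos s, sin s) - (cos t, sin t)) ^+ 2 = 2 - 2 * cos (s - t).
Proof.
rewrite enorm_sqr /= cosB; have := cos2Dsin2 s; have := cos2Dsin2 t.
by move=> ht hs; lra.
Qed.

Lemma wedge_polar (s t : R) :
  wedge (cos s, sin s) (cos t, sin t) = - sin (s - t).
Proof. by rewrite /wedge /= sinB; ring. Qed.

End Plane.

(** * Limits of plane vectors *)

Section Limits.
Context {R : realType} {T : Type} {F : set_system T} {FF : Filter F}.
Implicit Types u v : T -> R * R.

Lemma cvg_coord1 u (a : R * R) : u @ F --> a -> (u x).1 @[x --> F] --> a.1.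
Proof. by move=> ua; exact: (cvg_comp _ _ ua cvg_fst). Qed.

Lemma cvg_coord2 u (a : R * R) : u @ F --> a -> (u x).2 @[x --> F] --> a.2.
Proof. by move=> ua; exact: (cvg_comp _ _ ua cvg_snd). Qed.

Lemma cvg_wedge u v (a b : R * R) : u @ F --> a -> v @ F --> b ->
  wedge (u x) (v x) @[x --> F] --> wedge a b.
Proof.
move=> ua vb; apply: cvgB; apply: cvgM.
- exact: cvg_coord1.
- exact: cvg_coord2.
- exact: cvg_coord2.
- exact: cvg_coord1.
Qed.

Lemma cvg_enorm_sqr u (a : R * R) : u @ F --> a ->
  enorm (u x) ^+ 2 @[x --> F] --> enorm a ^+ 2.
Proof.
move=> ua; rewrite enorm_sqr; under eq_fun do rewrite enorm_sqr.
by apply: cvgD; rewrite expr2; under eq_fun do rewrite expr2;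
  apply: cvgM; (exact: cvg_coord1 || exact: cvg_coord2).
Qed.

Lemma cvg_heliocentric (N : nat) (q : T -> 'I_N.+1 -> R * R) qbar :
  (forall j, q x j @[x --> F] --> qbar j) ->
  forall i, heliocentric (q x) i @[x --> F] --> heliocentric qbar i.
Proof. by move=> hq i; apply: cvgB; exact: hq. Qed.

End Limits.

(** * Balance of torques *)

(** Pairing the equations of the vortex a and of the strong vortex with
    Z_a turns each rotation term into the same quantity
    omega * wedge Z_a (q ord0), because q_a and q_0 differ by Z_a; comparing
    the two equations removes it. The strong vortex exerts no torque on a, so
    only small circulations survive. *)
Lemma torque_balance (R : realType) (N : nat) (omega : R) (Gamma : 'I_N.+1 -> R)
    (q : 'I_N.+1 -> R * R) (a : 'I_N) :
  relative_equilibrium omega Gamma q ->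
  \sum_(b | b != a) Gamma (lift ord0 b)
     * (wedge (heliocentric q a) (heliocentric q b)
        * ((enorm (heliocentric q a - heliocentric q b) ^+ 2)^-1
           - (enorm (heliocentric q b) ^+ 2)^-1)) = 0.
Proof.
set Z := heliocentric q; set z := Z a; case=> Gamma0 _ _ eqm.
have torque i : omega * wedge z (q i) +
    \sum_(j | j != i) Gamma j / enorm (q i - q j) ^+ 2 * wedge z (q j - q i) = 0.
  have /(congr1 (dot z)) := eqm i.
  rewrite dotDr dot0r dot_sumr dotZ_perp.
  under eq_bigr do rewrite dotZ_perp.
  rewrite sumrN -opprD => /eqP; rewrite oppr_eq0 => /eqP e.
  apply: (mulfI (Gamma0 i)); rewrite mulr0 -[RHS]e mulrDr mulr_sumr.
  by congr (_ + _); [ring | apply: eq_bigr => j _; ring].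
have := torque ord0; have := torque (lift ord0 a).
rewrite 2!(big_mkcond (fun i => i != _)) !big_ord_recl /=.
set c := Gamma ord0 / _ * _.
(* The pull [c] of the strong vortex on [a] is parallel to [z]: no torque. *)
have -> : c = 0 by rewrite /c /z /Z /heliocentric /wedge /=; ring.
have -> : wedge z (q (lift ord0 a)) = wedge z (q ord0).
  by rewrite /z /Z /heliocentric /wedge /=; ring.
rewrite !add0r => ha h0.
have {ha h0} : omega * wedge z (q ord0) + \sum_(b | b != a)
      Gamma (lift ord0 b) / enorm (z - Z b) ^+ 2 * wedge z (Z b)
    = omega * wedge z (q ord0) + \sum_(b | b != a)
      Gamma (lift ord0 b) / enorm (Z b) ^+ 2 * wedge z (Z b).
  rewrite big_mkcond [X in _ = _ + X]big_mkcond/=.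
  transitivity (0 : R); [rewrite -[RHS]ha|rewrite -[LHS]h0]; congr (_ + _).
    apply: eq_bigr => b _; rewrite (inj_eq lift_inj); case: eqP => // _.
    rewrite /= /z /Z /heliocentric; congr (_ / _ * _).
      by congr (enorm _ ^+ 2); rewrite opprB addrA subrK.
    by rewrite /wedge /=; ring.
  (* In the equation of the strong vortex the term of [a] itself vanishes. *)
  apply: eq_bigr => b _; rewrite /= enorm_sqrB; case: eqP => // ->.
  by rewrite -/(Z a) /wedge /=; ring.
move=> /addrI /eqP; rewrite -subr_eq0 -sumrB => /eqP e.
by rewrite -[RHS]e; apply: eq_bigr => b _; ring.
Qed.

(** The uniform separation along the approximating sequence survives, as a
    weak inequality, in the limit; this is what keeps the denominators away
    from 0. *)
Lemma limit_no_collision (R : realType) (N : nat) (mu : 'I_N -> R)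
    (qbar : 'I_N.+1 -> R * R) (a b : 'I_N) :
  limit_relative_equilibrium mu qbar -> a != b ->
  0 < enorm (heliocentric qbar a - heliocentric qbar b) ^+ 2.
Proof.
move=> [eps [q [_ _ _ qcvg [m m0 sep]]]] ab.
have Zcvg i : heliocentric (q k) i @[k --> \oo] --> heliocentric qbar i.
  exact: cvg_heliocentric.
apply: (@lt_le_trans _ _ (m ^+ 2)); first by rewrite exprn_gt0.
apply: (cvgr_to_ge (cvg_enorm_sqr _ _ (cvgB (Zcvg a) (Zcvg b)))).
apply: nearW => k; have := sep k (lift ord0 a) (lift ord0 b).
rewrite (inj_eq lift_inj) => /(_ ab) mlt.
rewrite /heliocentric opprB addrA subrK.
by rewrite lerXn2r ?nnegrE ?(ltW m0) ?enorm_ge0 ?(ltW mlt).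
Qed.

(** Every circulation in [torque_balance] contains the factor epsilon, which is
    nonzero and cancels before the limit is taken. *)
Lemma limit_torque_balance (R : realType) (N : nat) (mu : 'I_N -> R)
    (qbar : 'I_N.+1 -> R * R) (a : 'I_N) :
  (forall b, heliocentric qbar b != 0) ->
  limit_relative_equilibrium mu qbar ->
  \sum_(b | b != a) mu b
     * (wedge (heliocentric qbar a) (heliocentric qbar b)
        * ((enorm (heliocentric qbar a - heliocentric qbar b) ^+ 2)^-1
           - (enorm (heliocentric qbar b) ^+ 2)^-1)) = 0.
Proof.
move=> Zbar0 lim; have [eps [q [eps0 _ eqm qcvg _]]] := lim.
set S := (X in X = 0).
pose f k := \sum_(b | b != a) mu b
     * (wedge (heliocentric (q k) a) (heliocentric (q k) b)
        * ((enorm (heliocentric (q k) a - heliocentric (q k) b) ^+ 2)^-1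
           - (enorm (heliocentric (q k) b) ^+ 2)^-1)).
have f0 k : f k = 0.
  apply: (mulfI (eps0 k)); rewrite mulr0 -[RHS](torque_balance _ _ _ _ _ a (eqm k)).
  rewrite mulr_sumr; apply: eq_bigr => b _.
  by rewrite /circulations liftK; exact: mulrA.
have Zcvg i : heliocentric (q k) i @[k --> \oo] --> heliocentric qbar i.
  exact: cvg_heliocentric.
have fS : f k @[k --> \oo] --> S.
  apply: cvg_big => // [|b ba]; first exact: add_continuous.
  apply: cvgM; first exact: cvg_cst.
  apply: cvgM; first exact: cvg_wedge.
  apply: cvgB; apply: cvgV.
  - by rewrite lt0r_neq0// (limit_no_collision _ _ _ _ _ _ lim)// eq_sym.
  - by apply: cvg_enorm_sqr; apply: cvgB.
  - by rewrite enorm_sqr_eq0.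
  - exact: cvg_enorm_sqr.
have flim0 : f k @[k --> \oo] --> (0 : R).
  by rewrite (_ : f = cst 0); [exact: cvg_cst | apply/funext => k; exact: f0].
exact: cvg_unique fS flim0.
Qed.

(** * Differential of the potential *)

Section Potential.
Context {R : realType}.

Definition pair_energy (x : R) : R := cos x + 2^-1 * ln (2 - 2 * cos x).

Definition pair_force (x : R) : R := sin x * ((2 - 2 * cos x)^-1 - 1).

(** Oddness of the force is the action-reaction principle: it makes the pair
    contributions antisymmetric, as [sum_antisym] requires. *)
Lemma pair_forceN x : pair_force (- x) = - pair_force x.
Proof. by rewrite /pair_force sinN cosN mulNr. Qed.

Lemma is_derive_pair_energy x : 0 < 2 - 2 * cos x ->
  is_derive x (1 : R) pair_energy (pair_force x).
Proof.
move=> x0.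
pose u (y : R) := 2 - 2 * cos y.
have h : is_derive x (1 : R) u (2 * sin x).
  by apply: is_derive_eq; rewrite /GRing.scale /=; ring.
have hc := @is_derive1_comp _ (@ln R) u x _ _ (is_derive1_ln x0) h.
have hd := is_deriveD (is_derive_cos x) (is_deriveZ 2^-1 hc).
apply: (is_derive_eq hd); rewrite /pair_force /GRing.scale /=.
by field; rewrite gt_eqF.
Qed.

Lemma is_diff_real (f : R -> R) (x l : R) : is_derive x (1 : R) f l ->
  is_diff x f (fun h => h * l).
Proof.
move=> [df fl]; have fx : differentiable f x by exact/derivable1_diffP.
by apply: DiffDef => //; rewrite diff1E// derive1E fl.
Qed.

Lemma is_diff_coord n (t : 'rV[R]_n) (i : 'I_n) :
  is_diff t (fun s : 'rV[R]_n => s ord0 i) (fun s => s ord0 i).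
Proof.
pose f (s : 'rV[R]_n) := s ord0 i.
have lf : linear f by move=> k u v; rewrite /f !mxE.
pose fM := GRing.isLinear.Build _ _ _ _ _ lf.
pose fL : {linear _ -> _} := HB.pack f fM.
apply: DiffDef; first exact: differentiable_coord.
by rewrite -[LHS]/('d fL t : _ -> _) diff_lin//; exact: coord_continuous.
Qed.

Lemma is_diff_big (U W : normedModType R) (I : Type) (r : seq I) (P : pred I)
    (f df : I -> U -> W) (x : U) :
  (forall i, P i -> is_diff x (f i) (df i)) ->
  is_diff x (fun y => \sum_(i <- r | P i) f i y)
            (fun v => \sum_(i <- r | P i) df i v).
Proof.
move=> h; elim: r => [|i r ih].
  have e (g : I -> U -> W) : (fun y => \sum_(i <- [::] | P i) g i y) = cst 0.
    by apply/funext => y; rewrite big_nil.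
  by rewrite !e; exact: is_diff_cst.
have e (g : I -> U -> W) : (fun y => \sum_(j <- i :: r | P j) g j y)
    = if P i then g i + (fun y => \sum_(j <- r | P j) g j y)
      else (fun y => \sum_(j <- r | P j) g j y).
  by apply/funext => y; rewrite big_cons; case: ifP.
by rewrite !e; case: ifP => // Pi; have hi := h i Pi; exact: is_diffD.
Qed.

(** With A the matrix of pair forces, the left-hand side is the differential of
    a pair potential as it comes from differentiating pair by pair, and the
    right-hand side shows its partial derivatives as the coefficients of v. *)
Lemma sum_antisym n (A : 'I_n -> 'I_n -> R) (v : 'I_n -> R) :
  (forall i j, A j i = - A i j) ->
  \sum_(i < n) \sum_(j < n | (i < j)%N) A i j * (v i - v j)
  = \sum_(i < n) v i * \sum_(j < n | j != i) A i j.
Proof.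
move=> Aanti.
under eq_bigr do under eq_bigr do rewrite mulrBr.
under eq_bigr do rewrite sumrB.
(* Exchanging the indices of the terms in v j turns them into terms in v i. *)
rewrite sumrB [X in _ - X](exchange_big_dep xpredT)//= -sumrB.
apply: eq_bigr => i _.
rewrite [X in _ = v i * X](bigID (fun j : 'I_n => (i < j)%N))/= mulrDr.
rewrite -sumrN !mulr_sumr.
congr (_ + _); apply: eq_big => j.
- by rewrite -val_eqE /=; case: ltngtP.
- by move=> _; rewrite mulrC.
- by rewrite -val_eqE /=; case: ltngtP.
- by move=> _; rewrite (Aanti i j) mulNr opprK mulrC.
Qed.

Lemma is_diff_V n (mu : 'I_n -> R) (t : 'rV[R]_n) : V_domain R n t ->
  is_diff t (V mu) (fun v => - \sum_(i < n) v ord0 i * (mu i *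
    \sum_(j < n | j != i) mu j * pair_force (t ord0 i - t ord0 j))).
Proof.
move=> tD.
have pairD (i j : 'I_n) : (i < j)%N ->
    is_diff t (fun s : 'rV[R]_n => mu i * mu j * pair_energy (s ord0 i - s ord0 j))
      (fun v => mu i * mu j * pair_force (t ord0 i - t ord0 j) * (v ord0 i - v ord0 j)).
  move=> ij; have /is_derive_pair_energy/is_diff_real hg := tD i j ij.
  have hij := @is_diffB _ _ _ _ _ _ _ t (is_diff_coord _ t i) (is_diff_coord _ t j).
  have hc := @is_diff_comp _ _ _ _ _ _ _ _ t hij hg.
  have hz := @is_diffZ _ _ _ _ _ (mu i * mu j) t hc.
  apply: (is_diff_eq hz); apply/funext => v /=.
  rewrite -[LHS]/(mu i * mu j * ((v ord0 i - v ord0 j)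
    * pair_force (t ord0 i - t ord0 j))).
  by ring.
have hV := @is_diffN _ _ _ _ _ t (is_diff_big _ _ _ (index_enum 'I_n) xpredT _ _ t
  (fun i _ => is_diff_big _ _ _ (index_enum 'I_n) _ _ _ t (pairD i))).
apply: (is_diff_eq hV); apply/funext => v /=; congr (- _).
rewrite (sum_antisym _ (fun i j =>
  mu i * mu j * pair_force (t ord0 i - t ord0 j)) (v ord0)); last first.
  by move=> i j; rewrite -opprB pair_forceN; ring.
apply: eq_bigr => i _; congr (_ * _); rewrite mulr_sumr.
by apply: eq_bigr => j _; rewrite mulrA.
Qed.

End Potential.

Theorem theorem1 (R : realType) (N : nat) (mu : 'I_N -> R)
    (thetabar : 'rV[R]_N)
    (hN : (1 <= N)%N)
    (hmu : forall i, mu i != 0)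
    (heq : polar_limit_relative_equilibrium mu (const_mx 1) thetabar) :
  critical_point (V_domain R N) (V mu) thetabar.
Proof.
case: heq => qbar lim polar.
have Zbar i : heliocentric qbar i = (cos (thetabar ord0 i), sin (thetabar ord0 i)).
  by rewrite polar mxE !mul1r.
have chord i j : i != j -> 0 < 2 - 2 * cos (thetabar ord0 i - thetabar ord0 j).
  move=> ij; rewrite -chord_polar -!Zbar.
  exact: (limit_no_collision _ _ _ _ _ _ lim ij).
have dom : V_domain R N thetabar.
  by move=> i j ij; apply: chord; rewrite -val_eqE /= ltn_eqF.
have [diffV dV] := is_diff_V N mu thetabar dom; split=> //.
move=> v; rewrite dV; apply/eqP; rewrite oppr_eq0; apply/eqP.
apply: big1 => a _.
suff -> : \sum_(j < N | j != a)
    mu j * pair_force (thetabar ord0 a - thetabar ord0 j) = 0 by rewrite !mulr0.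
have Zbar0 b : heliocentric qbar b != 0.
  by rewrite Zbar -enorm_sqr_eq0 enorm_polar oner_eq0.
have /eqP := limit_torque_balance _ _ _ _ a Zbar0 lim.
rewrite -oppr_eq0 -sumrN => /eqP e; rewrite -[RHS]e; apply: eq_bigr => b _.
rewrite !Zbar chord_polar wedge_polar enorm_polar /pair_force invr1.
by ring.
Qed.
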